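(* Let $G$ be a finite simple graph with vertex set $V(G)=\{v_1,\dots,v_k,\dots,v_n\}$, where $1<k<n$. Suppose that (i) $\bigcup_{i=1}^{k}N[v_i]=V(G)$; (ii) $|d(v_i)-d(v_j)|>1$ for every $i\in\{1,\dots,k\}$ and every $j\in\{1,\dots,n\}\setminus\{i\}$; (iii) $N[v_1]\cap \bigcup_{i=2}^{k}N[v_i]=\emptyset$. Then $G$ is reconstructible.
   Context: Graphs are finite, simple and undirected. For a vertex $v$ of $G$, $d(v)$ denotes its degree, $N(v)=\{u\in V(G)\mid uv\in E(G)\}$ is its open neighborhood and $N[v]=N(v)\cup\{v\}$ its closed neighborhood. $G-v$ denotes the graph obtained by deleting the vertex $v$. A graph $G$ with $V(G)=\{v_1,\dots,v_n\}$ is called reconstructible if every graph $G'$ with $V(G')=\{v'_1,\dots,v'_n\}$ such that $G-v_j\cong G'-v'_j$ for all $j\in\{1,\dots,n\}$ is isomorphic to $G$. *)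

(* Defs.v *)
From mathcomp Require Import all_boot.

Set Implicit Arguments.
Unset Strict Implicit.
Unset Printing Implicit Defensive.

Record sgraph := SGraph {
  vertex :> finType;
  adj : rel vertex;
  adj_sym : symmetric adj;
  adj_irr : irreflexive adj }.

Definition open_nbhd (G : sgraph) (x : G) : {set G} := [set y | adj x y].

Definition closed_nbhd (G : sgraph) (x : G) : {set G} := x |: open_nbhd x.

Definition degree (G : sgraph) (x : G) : nat := #|open_nbhd x|.

Section DeleteVertex.
Variables (G : sgraph) (x : G).

Definition del_adj : rel {y : G | y != x} := fun y z => adj (val y) (val z).

Lemma del_adj_sym : symmetric del_adj.
Proof. by move=> y z; rewrite /del_adj adj_sym. Qed.

Lemma del_adj_irr : irreflexive del_adj.
Proof. by move=> y; rewrite /del_adj adj_irr. Qed.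

Definition del_vertex : sgraph := SGraph del_adj_sym del_adj_irr.
End DeleteVertex.

Definition isomorphic (G H : sgraph) : Prop :=
  exists2 f : G -> H, bijective f & forall x y, adj (f x) (f y) = adj x y.

(* The bijections v and v' are the labellings V(G) = {v_1, ..., v_n} and
   V(G') = {v'_1, ..., v'_n}; the property does not depend on the choice of v. *)
Definition reconstructible (G : sgraph) : Prop :=
  forall (n : nat) (v : 'I_n -> G), bijective v ->
  forall (G' : sgraph) (v' : 'I_n -> G'), bijective v' ->
    (forall j : 'I_n, isomorphic (del_vertex (v j)) (del_vertex (v' j))) ->
  isomorphic G G'.

(* Main.v *)
Require Import Defs.
From mathcomp Require Import all_boot all_algebra.
From mathcomp Require Import zify.

Set Implicit Arguments.
Unset Strict Implicit.
Unset Printing Implicit Defensive.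

(* By Kelly's counting argument the degrees are reconstructible.  In a card G - w every degree
   drops by at most one, so the degree gap forces an isomorphism G - w -> G' - w' to send each
   dominating vertex v_i <> w to v'_i.  Comparing the degrees of v_i and v'_i before and after the
   deletion gives v_i ~ w <-> v'_i ~ w'.  In the card G - v_1 the neighbours of v_1 are exactly the
   vertices outside the closed neighbourhoods of the v_i with i > 1, and the same holds in G', so
   the isomorphism G - v_1 -> G' - v'_1 extends by v_1 |-> v'_1. *)

Lemma degree_del_vertex (G : sgraph) (x : G) (y : del_vertex x) :
  degree (val y) = adj x (val y) + degree y.
Proof.
rewrite /degree (cardsD1 x) inE adj_sym; congr (_ + _).
rewrite -(card_imset _ val_inj); apply: eq_card => z.
rewrite !inE; apply/andP/imsetP => [[zx yz]|[u]].
  by exists (Sub z zx); rewrite ?inE.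
by rewrite inE => yu ->; split=> //; apply: valP u.
Qed.

Lemma degree_iso (G H : sgraph) (f : G -> H) :
  bijective f -> (forall x y, adj (f x) (f y) = adj x y) ->
  forall x, degree (f x) = degree x.
Proof.
move=> f_bij f_adj x; rewrite /degree -(card_imset _ (bij_inj f_bij)).
case: f_bij => g fK gK; apply: eq_card => z.
rewrite inE -[z in LHS]gK f_adj; apply/idP/imsetP => [xz|[u]].
  by exists (g z); rewrite ?inE.
by rewrite inE => xu ->; rewrite fK.
Qed.

Definition degree_sum (G : sgraph) : nat := \sum_(x : G) degree x.

Lemma degree_sum_iso (G H : sgraph) :
  isomorphic G H -> degree_sum G = degree_sum H.
Proof.
case=> f f_bij f_adj; rewrite /degree_sum (reindex f (onW_bij _ f_bij)).
by apply: eq_bigr => x _; rewrite degree_iso.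
Qed.

(** Each edge at [x] counts once in [degree x] and once in the degree of its other end; both
    contributions vanish with [x]. *)
Lemma degree_sum_del_vertex (G : sgraph) (x : G) :
  degree_sum G = 2 * degree x + degree_sum (del_vertex x).
Proof.
have sum_del (F : G -> nat) :
    \sum_(y | y != x) F y = \sum_(y : del_vertex x) F (val y).
  rewrite (reindex_omap (val : del_vertex x -> G) insub) /=.
    by apply: eq_bigl => y; rewrite (valP y) valK eqxx.
  by move=> y yx; rewrite insubT.
rewrite /degree_sum (bigD1 x) //= sum_del.
under eq_bigr do rewrite degree_del_vertex.
rewrite big_split /= addnA mul2n -addnn; congr (_ + _ + _).
rewrite -(sum_del (fun y => adj x y : nat)) /degree -sum1dep_card [RHS]big_mkcond.
rewrite [RHS](bigD1 x) //= adj_irr add0n.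
by apply: eq_bigr => y _; case: adj.
Qed.

(** Summing the deletion formula over all vertices shows that the cards determine
    [(#|G| - 2) * degree_sum G]. The factor is positive, so they determine [degree_sum G], and
    [degree x] is half of what deleting [x] removes from it. *)
Lemma degree_reconstruction (G G' : sgraph) (s : G -> G') :
  bijective s -> 2 < #|G| ->
  (forall x, isomorphic (del_vertex x) (del_vertex (s x))) ->
  forall x, degree (s x) = degree x.
Proof.
move=> s_bij G_gt2 cards.
have kelly (H : sgraph) :
    #|H| * degree_sum H
      = 2 * degree_sum H + \sum_(x : H) degree_sum (del_vertex x).
  rewrite -sum_nat_const [X in 2 * X]/degree_sum big_distrr -big_split /=.
  by apply: eq_bigr => x _; apply: degree_sum_del_vertex.
have eq_sum : degree_sum G = degree_sum G'.
  have := kelly G'; rewrite (reindex s (onW_bij _ s_bij)) /=.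
  under eq_bigr do rewrite -(degree_sum_iso (cards _)).
  rewrite -(bij_eq_card s_bij); have := kelly G; nia.
move=> x; have := degree_sum_del_vertex x; have := degree_sum_del_vertex (s x).
by rewrite (degree_sum_iso (cards x)) eq_sum; lia.
Qed.

Section IsolatedDegrees.
Variables (G G' : sgraph) (s : G -> G') (d : G).
Hypotheses (s_bij : bijective s) (G_gt2 : 2 < #|G|).
Hypothesis cards : forall x, isomorphic (del_vertex x) (del_vertex (s x)).
Hypothesis d_gap : forall y, y != d -> 1 < `|degree d - degree y|%N.

(** Since [y] and [f y] have equal degrees in their cards and each lost at most one, the vertex that
    [s] sends to [f y] has degree within one of [degree d]. By the gap it is [d]. *)
Lemma card_iso_isolated_degree (x : G) (f : del_vertex x -> del_vertex (s x))
    (y : del_vertex x) :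
  bijective f -> (forall u w, adj (f u) (f w) = adj u w) ->
  val y = d -> val (f y) = s d.
Proof.
move=> f_bij f_adj yd; have deg := degree_reconstruction s_bij G_gt2 cards.
have [t sK tK] := s_bij; rewrite -[LHS]tK; congr s; apply/eqP.
apply/contraT => /d_gap; rewrite -(deg (t _)) tK degree_del_vertex -yd.
by rewrite degree_del_vertex degree_iso //; lia.
Qed.

Lemma adj_isolated_degree (x : G) : adj (s d) (s x) = adj d x.
Proof.
have [->|xd] := eqVneq x d; first by rewrite !adj_irr.
have [f f_bij f_adj] := cards x; rewrite eq_sym in xd.
pose y : del_vertex x := Sub d xd.
have fy := @card_iso_isolated_degree _ f y f_bij f_adj erefl.
have : degree (val (f y)) = degree (val y).
  by rewrite fy (degree_reconstruction s_bij G_gt2 cards).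
(* Cancelling the common card degree leaves the two adjacencies to the deleted vertices, read as 0
   or 1. *)
rewrite !degree_del_vertex degree_iso // fy adj_sym (adj_sym x) => /addIn.
by case: adj; case: adj.
Qed.

End IsolatedDegrees.

(** A label-free form of the theorem: [D] plays the role of the dominating vertices and [a] that of
    the separated one. *)
Lemma reconstructible_of_isolated_degrees (G : sgraph) (D : {set G}) (a : G) :
  2 < #|G| -> a \in D ->
  (forall x, exists2 d, d \in D & x \in closed_nbhd d) ->
  (forall d y, d \in D -> y != d -> 1 < `|degree d - degree y|%N) ->
  (forall d, d \in D -> d != a -> [disjoint closed_nbhd a & closed_nbhd d]) ->
  reconstructible G.
Proof.
move=> G_gt2 aD dom gap sep n v [w vK wK] G' v' v'_bij cards0.
(* The two labellings combine into one matching of vertices with isomorphic cards; [s] itself need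
   not preserve adjacency. *)
pose s x := v' (w x).
have s_bij : bijective s by apply: bij_comp v'_bij _; exists v.
have cards x : isomorphic (del_vertex x) (del_vertex (s x)).
  by have := cards0 (w x); rewrite wK.
have [t sK tK] := s_bij.
have adj_s d x : d \in D -> adj (s d) (s x) = adj d x.
  by move=> dD; apply: adj_isolated_degree => // y; apply: gap.
have [f f_bij f_adj] := cards a.
(* Domination gives the left-to-right direction, separation the converse. *)
have far x : x != a ->
    ~~ adj a x = [exists d, [&& d \in D, d != a & x \in closed_nbhd d]].
  move=> xa; apply/idP/existsP => [ax|[d /and3P[dD da xd]]].
    have [d dD xd] := dom x; exists d; rewrite dD xd andbT /=.
    by apply: contraNneq ax => da; move: xd; rewrite da !inE (negPf xa).
  have /disjointFl/(_ xd) := sep d dD da.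
  by rewrite !inE (negPf xa) /= => ->.
have adj_f (y : del_vertex a) : adj (s a) (val (f y)) = adj a (val y).
  have fy : val (f y) = s (t (val (f y))) by rewrite tK.
  (* [z] may differ from [val y], but by [far] it suffices that the same [d] in [D] other than [a]
     cover both: adjacency to [d] passes from [z] to [f y] by [adj_s], then to [y] through [f]. *)
  set z := t _ in fy.
  have za : z != a by apply: contraTneq (valP (f y)) => za; rewrite fy za eqxx.
  rewrite fy adj_s //; apply: negb_inj; rewrite !far ?(valP y) //.
  apply: eq_existsb => d; case: (boolP (d \in D)) => //= dD.
  case: (boolP (d != a)) => //= da.
  have fd : val (f (Sub d da)) = s d.
    by apply: (card_iso_isolated_degree s_bij G_gt2 cards) => // u; apply: gap.
  rewrite !inE -(adj_s d) // -fy -fd.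
  rewrite -[adj (val _) _]/(adj (f (Sub d da)) (f y)) f_adj; congr (_ || _).
  rewrite -(bij_eq s_bij) -fy -fd (inj_eq val_inj) (bij_eq f_bij).
  by rewrite -(inj_eq val_inj).
(* [insub] fails only at [a], so the default branch is exactly the value at [a]. *)
pose h x := if insub x is Some y then val (f y) else s a.
have ha : h a = s a by rewrite /h insubF ?eqxx.
have hy (y : del_vertex a) : h (val y) = val (f y) by rewrite /h valK.
have del_or x : x = a \/ exists y : del_vertex a, x = val y.
  have [->|xa] := eqVneq x a; first by left.
  by right; exists (Sub x xa).
exists h.
  apply: inj_card_bij; last by rewrite (bij_eq_card s_bij).
  move=> x x'; case: (del_or x) => [->|[y ->]]; case: (del_or x') => [->|[y' ->]];
    rewrite ?ha ?hy //.
  - by move=> e; have := valP (f y'); rewrite -e eqxx.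
  - by move=> e; have := valP (f y); rewrite e eqxx.
  - by move/val_inj/(bij_inj f_bij) => ->.
move=> x x'; case: (del_or x) => [->|[y ->]]; case: (del_or x') => [->|[y' ->]];
  rewrite ?ha ?hy ?adj_irr ?adj_f //.
  by rewrite adj_sym adj_f adj_sym.
exact: f_adj.
Qed.

(* Indices are 0-based: v i stands for v_(i+1), so i < k ranges over v_1, ..., v_k
   and the ordinal of value 0 indexes v_1. *)
Theorem mainTheorem1 (G : sgraph) (n k : nat) (v : 'I_n -> G)
    (v_bij : bijective v) (k_gt1 : 1 < k) (k_ltn : k < n)
    (dominating : \bigcup_(i < n | i < k) closed_nbhd (v i) = [set: G])
    (degree_gap : forall i j : 'I_n, i < k -> j != i ->
       1 < `|degree (v i) - degree (v j)|%N)
    (separated : closed_nbhd (v (Ordinal (ltn_trans (ltnW k_gt1) k_ltn)))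
       :&: \bigcup_(i < n | 1 <= i < k) closed_nbhd (v i) = set0) :
  reconstructible G.
Proof.
set i0 := Ordinal _ in separated; have v_inj := bij_inj v_bij.
have [w vK wK] := v_bij.
apply: (@reconstructible_of_isolated_degrees G [set v i | i : 'I_n & i < k] (v i0)).
(* The bounds [1 < k < n] supply the three vertices that Kelly's count requires. *)
- by rewrite -(bij_eq_card v_bij) card_ord; exact: (leq_ltn_trans k_gt1 k_ltn).
- by apply/imsetP; exists i0; rewrite ?inE //; exact: ltnW k_gt1.
- move=> x; have /bigcupP[i ik xi] : x \in \bigcup_(i < n | i < k) closed_nbhd (v i).
    by rewrite dominating.
  by exists (v i) => //; apply: imset_f; rewrite inE.
- move=> _ y /imsetP[i + ->]; rewrite inE -(wK y) (inj_eq v_inj).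
  exact: degree_gap.
- move=> _ /imsetP[i + ->]; rewrite inE (inj_eq v_inj) => ik i_neq0.
  have i_gt0 : 0 < i by rewrite lt0n; apply: contraNneq i_neq0 => i0E; apply/eqP/val_inj.
  rewrite -setI_eq0 -subset0 -separated setIS //.
  by apply: (bigcup_sup i); rewrite i_gt0.
Qed.
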